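(* Let $A \in \mathbb{R}^{n \times n}$ be a skew-symmetric matrix, i.e. $A^T = -A$, which has been reduced by an orthogonal similarity to lower antitriangular form. If some element of its main antidiagonal is zero, apply the antidiagonal annihilation process described in the context, which by Givens rotations (orthogonal similarities) makes all elements of the main antidiagonal zero. If all the elements on the first nontrivial antidiagonal of the resulting matrix are nonzero, then the matrix has rank $n-1$. Otherwise, the process is continued, antidiagonal after antidiagonal, until all elements of some antidiagonal are nonzero. The count of the elements on that antidiagonal is the rank of the matrix.
   Context: For an integer $s$, the antidiagonal $i+j=s$ of an $n\times n$ matrix is the set of entries at positions $(i,j)$, $1\le i,j\le n$, with $i+j=s$; the main antidiagonal is $i+j=n+1$. A matrix $M=(m_{ij})$ of order $n$ is lower antitriangular if $m_{ij}=0$ whenever $i+j<n+1$; every real skew-symmetric $A$ can be written as $A=QMQ^T$ with $Q$ orthogonal and $M$ lower antitriangular (and skew-symmetric). The first nontrivial antidiagonal after the main antidiagonal has been annihilated is $i+j=n+2$, which has $n-1$ elements. Annihilation process for the main antidiagonal of a lower antitriangular skew-symmetric matrix; every Givens rotation is applied as a two-sided orthogonal similarity, so it annihilates an element together with its mirror image across the main diagonal. (a) Even order $n$, singular matrix: some antidiagonal entry $(\ell,n-\ell+1)$, $\ell\le n-\ell+1$, is zero, and hence so is $(n-\ell+1,\ell)$; if there is more than one such pair, take the zero with the smallest difference of its column and row indices. Annihilate the elements $(\ell+1,n-\ell)$ and $(n-\ell,\ell+1)$ by a rotation in the plane $(n-\ell,n-\ell+1)$, and proceed similarly until all the antidiagonal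 elements between $(\ell,n-\ell+1)$ and $(n-\ell+1,\ell)$ are zero. Then annihilate $(n-\ell+2,\ell-1)$ and $(\ell-1,n-\ell+2)$ by a rotation in the plane $(\ell-1,\ell)$, and proceed outwards in the same way. (b) Odd order $n$: the antidiagonal contains a diagonal entry, which is zero. Annihilate first the elements $(\lceil n/2\rceil+1,\lceil n/2\rceil-1)$ and $(\lceil n/2\rceil-1,\lceil n/2\rceil+1)$ by a rotation in the plane $(\lceil n/2\rceil-1,\lceil n/2\rceil)$, and proceed outwards. In both cases the process finishes when the elements $(1,n)$ and $(n,1)$ are annihilated by a rotation in the plane $(1,2)$. *)

(* Defs.v *)
From HB Require Import structures.
From mathcomp Require Import all_boot all_order all_algebra.
From mathcomp Require Import reals.

Set Implicit Arguments.
Unset Strict Implicit.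
Unset Printing Implicit Defensive.

Import Order.TTheory GRing.Theory Num.Theory.

Local Open Scope ring_scope.

(* Positions are 1-based, as in the source: the ordinal [i : 'I_n] stands for
   the row or column number [i.+1]. *)

Definition skew_symmetric (R : realType) (n : nat) (A : 'M[R]_n) : Prop :=
  A^T = - A.

Definition orthogonal_mx (R : realType) (n : nat) (Q : 'M[R]_n) : Prop :=
  Q *m Q^T = 1%:M /\ Q^T *m Q = 1%:M.

Definition antidiagonal (n s : nat) : {set 'I_n * 'I_n} :=
  [set ij : 'I_n * 'I_n | (ij.1.+1 + ij.2.+1 == s)%N].

Definition antidiag_zero (R : realType) (n : nat) (M : 'M[R]_n) (s : nat)
  : Prop := forall i j, (i, j) \in antidiagonal n s -> M i j = 0.

(* Vacuously true when the antidiagonal is empty, e.g. for s = 2n + 1. *)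
Definition antidiag_nonzero (R : realType) (n : nat) (M : 'M[R]_n) (s : nat)
  : Prop := forall i j, (i, j) \in antidiagonal n s -> M i j != 0.

Definition lower_antitriangular (R : realType) (n : nat) (M : 'M[R]_n)
  : Prop := forall i j : 'I_n, (i.+1 + j.+1 < n.+1)%N -> M i j = 0.

Definition zero_at (R : realType) (n : nat) (M : 'M[R]_n) (x : nat * nat)
  : Prop :=
  exists i j : 'I_n, [/\ i.+1 = x.1, j.+1 = x.2 & M i j = 0].

Definition givens (R : realType) (n : nat) (p q : 'I_n) (c s : R) : 'M[R]_n :=
  \matrix_(i, j)
    if (i, j) == (p, p) then c
    else if (i, j) == (q, q) then c
    else if (i, j) == (p, q) then s
    else if (i, j) == (q, p) then - s
    else (i == j)%:R.

Record rotation := Rotation { target : nat * nat; plane : nat * nat }.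

(* One rotation, performed on the trailing principal submatrix made of the rows
   and columns r+1, ..., n: the positions in [g] are numbered inside it.  The
   angle is only constrained by the annihilation of the target entry and of its
   mirror image, so no sign convention for c and s is imposed. *)
Definition rotates (R : realType) (n r : nat) (g : rotation) (M N : 'M[R]_n)
  : Prop :=
  exists (p q : 'I_n) (c s : R),
    [/\ [/\ p.+1 = (r + (plane g).1)%N, q.+1 = (r + (plane g).2)%N & p != q],
        c ^+ 2 + s ^+ 2 = 1,
        N = givens p q c s *m M *m (givens p q c s)^T,
        zero_at N (r + (target g).1, r + (target g).2)%N
      & zero_at N (r + (target g).2, r + (target g).1)%N].

Fixpoint rotates_all (R : realType) (n r : nat) (gs : seq rotation)
    (M N : 'M[R]_n) : Prop :=
  if gs is g :: gs' then
    exists2 M', rotates r g M M' & rotates_all r gs' M' N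
  else N = M.

(* The antidiagonal entries of a matrix of order d with row numbers
   k = l+1, ..., d/2, in that order, for an initial zero in row l. *)
Definition inward (d l : nat) : seq rotation :=
  [seq Rotation (k, d - k + 1) (d - k + 1, d - k + 2)
  | k <- iota l.+1 (d./2 - l)]%N.

(* Same with the column numbers k = l-1, ..., 1. *)
Definition outward (d l : nat) : seq rotation :=
  [seq Rotation (d - k + 1, k) (k, k + 1) | k <- rev (iota 1 (l - 1))]%N.

Definition schedule (d l : nat) : seq rotation :=
  if odd d then outward d l else inward d l ++ outward d l.

Definition upper_zero (R : realType) (n r : nat) (M : 'M[R]_n) (l : nat)
  : Prop :=
  [/\ (0 < l)%N, (l <= n - r - l + 1)%N
    & zero_at M (r + l, r + (n - r - l + 1))%N].

(* The row number, in the trailing submatrix of order n - r, of the zero from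
   which the process starts; [uphalf d] is the ceiling of d/2. *)
Definition starting_row (R : realType) (n r : nat) (M : 'M[R]_n) (l : nat)
  : Prop :=
  if odd (n - r) then l = uphalf (n - r)
  else upper_zero r M l /\
       forall k, upper_zero r M k ->
         (n - r - l + 1 - l <= n - r - k + 1 - k)%N.

(* The annihilation process for the antidiagonal i + j = n + 1 + r, which is the
   main antidiagonal of the trailing submatrix of order n - r. *)
Definition annihilation (R : realType) (n r : nat) (M N : 'M[R]_n) : Prop :=
  exists2 l, starting_row r M l & rotates_all r (schedule (n - r) l) M N.

(* Whatever rotations were chosen so far, the next prescribed one exists. *)
Definition annihilation_unblocked (R : realType) (n r : nat) (M : 'M[R]_n)
  : Prop :=
  (exists l, starting_row r M l) /\
  forall l gs g gs' M', starting_row r M l ->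
    schedule (n - r) l = gs ++ g :: gs' -> rotates_all r gs M M' ->
    exists M'', rotates r g M' M''.

(* [reached M r N]: N is obtained from M by annihilating one after the other the
   antidiagonals i + j = n+1, ..., n+r, none of which had only nonzero entries
   when its turn came. *)
Inductive reached (R : realType) (n : nat) (M : 'M[R]_n)
  : nat -> 'M[R]_n -> Prop :=
| reached0 : reached M 0 M
| reachedS r N N' :
    reached M r N -> ~ antidiag_nonzero N (n + 1 + r) ->
    annihilation r N N' -> reached M r.+1 N'.

(* Main.v *)
Require Import Defs.
From HB Require Import structures.
From mathcomp Require Import all_boot all_order all_algebra.
From mathcomp Require Import reals.
From mathcomp Require Import zify ring lra.

Set Implicit Arguments.
Unset Strict Implicit.
Unset Printing Implicit Defensive.

Import Order.TTheory GRing.Theory Num.Theory.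

Local Open Scope ring_scope.

(* Work in the trailing principal submatrix of order d = n - r.  Both the inward
   and the outward rotations act in a plane (m, m + 1) and annihilate the
   antidiagonal entries of row and column m, knowing that those of row and
   column m + 1 vanish already.  That knowledge is what keeps the entries above
   the antidiagonal zero; skew-symmetry deals with the diagonal ones.  So
   m runs down and the zeros on the antidiagonal fill rows m, ..., d - l + 1
   (and, by mirror symmetry, l, ..., d - m + 1) until m = 1.  The rank is
   invariant, and a lower antitriangular block of order d with nonzero
   antidiagonal has rank d. *)

(** * Givens rotations, orthogonal similarity and skew-symmetry *)

Lemma mul_givens (R : realType) (n : nat) (p q : 'I_n) (c s : R)
    (X : 'M[R]_n) (i j : 'I_n) : p != q ->
  (givens p q c s *m X) i j =
    if i == p then c * X p j + s * X q j
    else if i == q then - s * X p j + c * X q j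
    else X i j.
Proof.
move=> npq; have nqp : q != p by rewrite eq_sym.
rewrite mxE.
case: eqVneq => [->|nip].
  rewrite (bigD1 p) //= (bigD1 q) //= big1 ?addr0; last first.
    move=> k /andP[kp kq]; rewrite mxE !xpair_eqE eqxx /= (negPf kp) (negPf kq).
    by rewrite (negPf npq) /= eq_sym (negPf kp) mul0r.
  by rewrite !mxE !xpair_eqE !eqxx (negPf npq) (negPf nqp).
case: eqVneq => [->|niq].
  rewrite (bigD1 p) //= (bigD1 q) //= big1 ?addr0; last first.
    move=> k /andP[kp kq]; rewrite mxE !xpair_eqE eqxx /= (negPf kp) (negPf kq).
    by rewrite (negPf nqp) /= eq_sym (negPf kq) mul0r.
  by rewrite !mxE !xpair_eqE !eqxx (negPf npq) (negPf nqp).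
rewrite (bigD1 i) //= big1 ?addr0; last first.
  move=> k ki; rewrite mxE !xpair_eqE (negPf nip) (negPf niq) /=.
  by rewrite eq_sym (negPf ki) mul0r.
by rewrite mxE !xpair_eqE (negPf nip) (negPf niq) eqxx mul1r.
Qed.

Lemma mul_givens_tr (R : realType) (n : nat) (p q : 'I_n) (c s : R)
    (X : 'M[R]_n) (i j : 'I_n) : p != q ->
  (X *m (givens p q c s)^T) i j =
    if j == p then c * X i p + s * X i q
    else if j == q then - s * X i p + c * X i q
    else X i j.
Proof.
move=> npq; rewrite -[X in X *m _]trmxK -trmx_mul mxE mul_givens //.
by rewrite !mxE.
Qed.

Lemma givens_unit (R : realType) (n : nat) (p q : 'I_n) (c s : R) :
  p != q -> c ^+ 2 + s ^+ 2 = 1 -> givens p q c s \in unitmx.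
Proof.
move=> npq cs1; have nqp : q != p by rewrite eq_sym.
suff /mulmx1_unit[] : givens p q c s *m (givens p q c s)^T = 1%:M by [].
have csq1 : s ^+ 2 + c ^+ 2 = 1 by rewrite addrC.
apply/matrixP => i j; rewrite mul_givens // !mxE !xpair_eqE [i == j]eq_sym.
case: (eqVneq j p) => [jp|njp]; case: (eqVneq j q) => [jq|njq];
  case: (eqVneq i p) => [ip|nip]; case: (eqVneq i q) => [iq|niq];
  subst; rewrite ?eqxx ?(negPf npq) ?(negPf nqp) ?(negPf njp) ?(negPf njq) //=.
all: rewrite ?mulr0 ?addr0 ?mulrNN -?expr2 //.
all: by first [ring | rewrite eqxx in npq].
Qed.

Lemma mxrank_similar (R : fieldType) (n : nat) (P M : 'M[R]_n) :
  P \in unitmx -> \rank (P *m M *m P^T) = \rank M.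
Proof.
move=> uP; rewrite mxrankMfree ?row_free_unit ?unitmx_tr //.
by rewrite eqmxMfull // row_full_unit.
Qed.

Lemma skew_similar (R : realType) (n : nat) (P M : 'M[R]_n) :
  skew_symmetric M -> skew_symmetric (P *m M *m P^T).
Proof.
by move=> Msk; rewrite /skew_symmetric !trmx_mul trmxK Msk mulNmx mulmxN mulmxA.
Qed.

Lemma skewE (R : realType) (n : nat) (M : 'M[R]_n) (i j : 'I_n) :
  skew_symmetric M -> M i j = - M j i.
Proof. by move=> /matrixP /(_ j i); rewrite !mxE. Qed.

Lemma skew_diag (R : realType) (n : nat) (M : 'M[R]_n) (i : 'I_n) :
  skew_symmetric M -> M i i = 0.
Proof. by move=> /(skewE i i) ?; lra. Qed.

(** The coefficients form the unit vector (b, -a) / h orthogonal to (a, b). The identity rotation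
    settles a = 0, so h never vanishes. *)
Lemma givens_annihilates (R : realType) (a b : R) :
  exists c s : R, c ^+ 2 + s ^+ 2 = 1 /\ c * a + s * b = 0.
Proof.
have [->|a0] := eqVneq a 0.
  by exists 1, 0; split; ring.
have ab_gt0 : 0 < a ^+ 2 + b ^+ 2.
  by rewrite ltr_pwDl ?sqr_ge0 // exprn_even_gt0.
pose h := Num.sqrt (a ^+ 2 + b ^+ 2).
have h0 : h != 0 by rewrite gt_eqF // sqrtr_gt0.
have h2 : h ^+ 2 = a ^+ 2 + b ^+ 2 by rewrite sqr_sqrtr // ltW.
exists (b / h), (- a / h); split; last by ring.
by rewrite !expr_div_n sqrrN -mulrDl addrC -h2 divff // expf_eq0.
Qed.

(** * Size of an antidiagonal and rank of an antitriangular block *)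

Lemma card_antidiagonal (n r : nat) :
  (r <= n)%N -> #|antidiagonal n (n + 1 + r)| = (n - r)%N.
Proof.
move=> le_rn.
(* In 0-based numbering the antidiagonal consists of the positions (r + i, n - 1 - i) with i < n -
   r. *)
have shiftP (i : 'I_(n - r)) : (r + i < n)%N by have := ltn_ord i; lia.
have mirrorP (i : 'I_(n - r)) : (n - i.+1 < n)%N by have := ltn_ord i; lia.
pose f i := (Ordinal (shiftP i), Ordinal (mirrorP i)).
have f_inj : injective f by move=> i j [] /eqP; rewrite eqn_add2l => /eqP /val_inj.
rewrite -[RHS]card_ord -(card_codom f_inj); apply: eq_card => -[i j].
rewrite inE /=; apply/idP/codomP => [/eqP ij|[k [-> ->]] /=]; last first.
  by have := ltn_ord k; lia.
have ltk : (i - r < n - r)%N by have := ltn_ord i; have := ltn_ord j; lia.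
exists (Ordinal ltk); congr pair; apply: val_inj => /=;
  by have := ltn_ord i; have := ltn_ord j; lia.
Qed.

(* Reversing the columns of the trailing submatrix makes it lower triangular
   with the antidiagonal entries on the diagonal. *)
Lemma rank_antitriangular (R : realType) (n r : nat) (M : 'M[R]_n) :
  (r <= n)%N ->
  (forall i j : 'I_n, (i.+1 + j.+1 < n + 1 + r)%N -> M i j = 0) ->
  antidiag_nonzero M (n + 1 + r) -> \rank M = (n - r)%N.
Proof.
move=> le_rn Mlow Mnz.
have shiftP (i : 'I_(n - r)) : (r + i < n)%N by have := ltn_ord i; lia.
have mirrorP (i : 'I_(n - r)) : (n - i.+1 < n)%N by have := ltn_ord i; lia.
pose f i := Ordinal (shiftP i); pose g i := Ordinal (mirrorP i).
apply/eqP; rewrite eqn_leq; apply/andP; split.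
  (* The first r rows vanish, so the remaining n - r rows span the row space. *)
  apply: leq_trans (rank_leq_row (rowsub f M)); apply: mxrankS.
  apply/row_subP => i; have [lt_ir|le_ri] := ltnP i r.
    rewrite (_ : row i M = 0) ?sub0mx //; apply/rowP => j; rewrite !mxE.
    by apply: Mlow; have := ltn_ord j; lia.
  have ltk : (i - r < n - r)%N by have := ltn_ord i; lia.
  rewrite (_ : i = f (Ordinal ltk)) -?row_rowsub ?row_sub //.
  by apply: val_inj => /=; lia.
(* Entry (i, j) of this minor lies i - j antidiagonals beyond the nonzero one, hence it is 0 for i <
   j. *)
have <- : \rank (mxsub f g M) = (n - r)%N.
  apply: mxrank_unit; rewrite unitmxE det_trig; last first.
    apply/is_trig_mxP => i j ltij; rewrite mxE.
    by apply: Mlow => /=; have := ltn_ord j; lia.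
  rewrite unitfE; apply/prodf_neq0 => i _; rewrite mxE; apply: Mnz.
  by rewrite inE /=; have := ltn_ord i; lia.
rewrite -mxrank_tr (_ : (mxsub f g M)^T = rowsub g (rowsub f M)^T); last first.
  by apply/matrixP => i j; rewrite !mxE.
apply: leq_trans (mxrankS (rowsub_sub _ _)) _.
by rewrite mxrank_tr; apply: mxrankS; apply: rowsub_sub.
Qed.

(** * A single rotation of the process *)

(* The bounds m and T are 1-based row numbers inside the trailing submatrix of
   order n - r. *)
Definition partly_annihilated (R : realType) (n r m T k : nat) (M : 'M[R]_n)
  : Prop :=
  [/\ skew_symmetric M,
      forall i j : 'I_n, (i.+1 + j.+1 < n + 1 + r)%N -> M i j = 0,
      forall i j : 'I_n, (i.+1 + j.+1 = n + 1 + r)%N ->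
        (r + m <= i.+1 <= r + T)%N -> M i j = 0
    & \rank M = k].

(** Common shape of both kinds of rotations: m = k for an outward one, m = d - k + 1 for an inward
    one. *)
Definition targets (d m : nat) (g : rotation) : Prop :=
  plane g = (m, m + 1)%N /\
  (target g = (m, d - m + 1)%N \/ target g = (d - m + 1, m)%N).

(** Skew-symmetry of N reduces the two prescribed zeros to a single one, in column p and its
    antidiagonal partner row y. *)
Lemma rotatesP (R : realType) (n r m : nat) (g : rotation) (M N : 'M[R]_n) :
  skew_symmetric M -> targets (n - r) m g ->
  rotates r g M N <->
  exists (p q y : 'I_n) (c s : R),
    [/\ [/\ p.+1 = (r + m)%N, q.+1 = (r + m + 1)%N
          & y.+1 = (r + (n - r - m + 1))%N],
        c ^+ 2 + s ^+ 2 = 1,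
        N = givens p q c s *m M *m (givens p q c s)^T
      & N y p = 0].
Proof.
move=> Msk [pl tg]; rewrite /rotates pl /=; split.
  case=> p [q [c [s [[pE qE npq] cs1 NE z1 z2]]]].
  suff [i [j [/= iE jE Nij]]] : zero_at N (r + (n - r - m + 1), r + m)%N.
    exists p, q, i, c, s; split=> //; first by split=> //; lia.
    by rewrite (_ : p = j) //; apply: val_inj => /=; lia.
  by case: tg z1 z2 => -> /=.
case=> p [q [y [c [s [[pE qE yE] cs1 NE Nyp]]]]].
have Npy : N p y = 0.
  by rewrite (skewE _ _ (_ : skew_symmetric N)) ?Nyp ?oppr0 // NE; apply: skew_similar.
exists p, q, c, s.
have npq : p != q by apply/eqP => pq; move: qE; rewrite -pq; lia.
by case: tg => -> /=; split=> //; try (by split=> //; lia);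
  [exists p, y | exists y, p | exists y, p | exists p, y].
Qed.

(** The conditions on 2 m say that row y lies outside the plane (p, q). The rotation then mixes only
    M y p and M y q into the new entry, and a suitable angle kills it. *)
Lemma rotates_exists (R : realType) (n r m T k : nat) (g : rotation)
    (M : 'M[R]_n) :
  (0 < m < n - r)%N -> (2 * m != n - r + 1)%N -> (2 * m != n - r)%N ->
  targets (n - r) m g -> partly_annihilated r m.+1 T k M ->
  exists N, rotates r g M N.
Proof.
move=> mb m1 m2 tg [Msk Mlow Mz _].
have pP : (r + m - 1 < n)%N by lia.
have qP : (r + m < n)%N by lia.
have yP : (n - m < n)%N by lia.
pose p := Ordinal pP; pose q := Ordinal qP; pose y := Ordinal yP.
have [c [s [cs1 cs0]]] := givens_annihilates (M y p) (M y q).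
exists (givens p q c s *m M *m (givens p q c s)^T).
apply/(rotatesP _ Msk tg); exists p, q, y, c, s.
have npq : p != q by apply/eqP => /(congr1 val) /=; lia.
have nyp : y != p by apply/eqP => /(congr1 val) /=; lia.
have nyq : y != q by apply/eqP => /(congr1 val) /=; lia.
split=> //=; first by split; lia.
by rewrite mul_givens_tr // eqxx !mul_givens // (negPf nyp) (negPf nyq).
Qed.

(** An index p or q is mixed with these two only, and any other index is kept, so the listed entries
    are the only ones contributing to (i, j). *)
Lemma givens_similar_eq0 (R : realType) (n : nat) (p q i j : 'I_n) (c s : R)
    (M : 'M[R]_n) : p != q ->
  (forall i' j' : 'I_n,
     i' = i \/ (i = p \/ i = q) /\ (i' = p \/ i' = q) ->
     j' = j \/ (j = p \/ j = q) /\ (j' = p \/ j' = q) -> M i' j' = 0) ->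
  (givens p q c s *m M *m (givens p q c s)^T) i j = 0.
Proof.
move=> npq M0; rewrite mul_givens_tr // !mul_givens //.
case: (eqVneq j p) => [jp|njp]; case: (eqVneq j q) => [jq|njq];
  case: (eqVneq i p) => [ip|nip]; case: (eqVneq i q) => [iq|niq];
  by rewrite !M0 ?(mulr0, addr0); intuition.
Qed.

Lemma rotates_partly_annihilated (R : realType) (n r m T k : nat)
    (g : rotation) (M N : 'M[R]_n) :
  (0 < m < n - r)%N -> (m < T)%N ->
  (2 * m != n - r + 1)%N -> (2 * m != n - r)%N ->
  targets (n - r) m g -> partly_annihilated r m.+1 T k M ->
  rotates r g M N -> partly_annihilated r m T k N.
Proof.
move=> mb mT m1 m2 tg [Msk Mlow Mz Mk].
case/(rotatesP _ Msk tg) => p [q [y [c [s [[pE qE yE] cs1 NE Nyp]]]]].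
have npq : p != q by apply/eqP => /(congr1 val) /=; lia.
have Nsk : skew_symmetric N by rewrite NE; apply: skew_similar.
have M0 (i j : 'I_n) : [|| i == j, (i.+1 + j.+1 < n + 1 + r)%N |
    (i.+1 + j.+1 == n + 1 + r)%N &&
    ((r + m.+1 <= i.+1 <= r + T)%N || (r + m.+1 <= j.+1 <= r + T)%N)] ->
    M i j = 0.
  case/or3P=> [/eqP->|ij|/andP[/eqP ij /orP[im|jm]]].
  - exact: skew_diag.
  - exact: Mlow.
  - exact: Mz.
  - by rewrite skewE // Mz ?oppr0 // addnC.
have ord_neq (i j : 'I_n) : (i == j) = (i == j :> nat) by [].
have ord_eq (i j : 'I_n) : i = j -> i = j :> nat by move->.
split=> //.
(* The contributing entries not above the antidiagonal are diagonal ones or antidiagonal ones in row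
   or column m + 1, all zero. *)
- move=> i j ij; rewrite NE; apply: givens_similar_eq0 => // i' j' hi hj.
  apply: M0; rewrite ord_neq.
  by case: hi hj => [/ord_eq ?|[[/ord_eq ?|/ord_eq ?] [/ord_eq ?|/ord_eq ?]]]
    [/ord_eq ?|[[/ord_eq ?|/ord_eq ?] [/ord_eq ?|/ord_eq ?]]]; lia.
- move=> i j ij im.
  (* In row or column m the zero is the one just created; elsewhere only vanishing entries are
     mixed. *)
  have [ip|nip] := eqVneq i p.
    rewrite (_ : j = y); first by rewrite ip skewE // Nyp oppr0.
    by apply: val_inj => /=; move: ij; rewrite ip; lia.
  have [jp|njp] := eqVneq j p.
    rewrite (_ : i = y); first by rewrite jp.
    by apply: val_inj => /=; move: ij; rewrite jp; lia.
  rewrite NE; apply: givens_similar_eq0 => // i' j' hi hj.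
  apply: M0; move: nip njp; rewrite !ord_neq.
  by case: hi hj => [/ord_eq ?|[[/ord_eq ?|/ord_eq ?] [/ord_eq ?|/ord_eq ?]]]
    [/ord_eq ?|[[/ord_eq ?|/ord_eq ?] [/ord_eq ?|/ord_eq ?]]]; lia.
- by rewrite NE mxrank_similar ?givens_unit.
Qed.

(** * Sequences of rotations: outward, inward and complete schedules *)

(* A Hoare triple for a list of rotations: from P, each prescribed rotation
   exists, and whatever choices are made, P' holds at the end. *)
Fixpoint feasible (R : realType) (n r : nat) (gs : seq rotation)
    (P P' : 'M[R]_n -> Prop) : Prop :=
  if gs is g :: gs' then
    exists P1 : 'M[R]_n -> Prop,
      (forall M, P M -> (exists N, rotates r g M N) /\
                        forall N, rotates r g M N -> P1 N)
      /\ feasible r gs' P1 P'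
  else forall M, P M -> P' M.

Lemma feasible_cat (R : realType) (n r : nat) (gs1 gs2 : seq rotation)
    (P1 P2 P3 : 'M[R]_n -> Prop) :
  feasible r gs1 P1 P2 -> feasible r gs2 P2 P3 -> feasible r (gs1 ++ gs2) P1 P3.
Proof.
elim: gs1 P1 => [|g gs1 IH] P1 /= f1 f2; last first.
  by case: f1 => P [gP f1]; exists P; split=> //; apply: IH.
case: gs2 f2 => [|g gs2] /= f2; first by move=> M /f1 /f2.
by case: f2 => P [gP f2]; exists P; split=> // M /f1 /gP.
Qed.

Lemma feasible_invariant (R : realType) (n r : nat) (gs : seq rotation)
    (P P' : 'M[R]_n -> Prop) (M N : 'M[R]_n) :
  feasible r gs P P' -> P M -> rotates_all r gs M N -> P' N.
Proof.
elim: gs P M => [|g gs IH] P M /= f PM; first by move->; apply: f.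
case: f => P1 [gP f] [M' rM]; apply: IH f _.
by case: (gP _ PM) => _; apply.
Qed.

Lemma feasible_exists (R : realType) (n r : nat) (gs : seq rotation)
    (P P' : 'M[R]_n -> Prop) (M : 'M[R]_n) :
  feasible r gs P P' -> P M -> exists N, rotates_all r gs M N.
Proof.
elim: gs P M => [|g gs IH] P M /= f PM; first by exists M.
case: f => P1 [/(_ _ PM) [[M' rM] P1M] f].
by have [N rN] := IH _ _ f (P1M _ rM); exists N, M'.
Qed.

Lemma feasible_next (R : realType) (n r : nat) (gs gs' : seq rotation)
    (g : rotation) (P P' : 'M[R]_n -> Prop) (M N : 'M[R]_n) :
  feasible r (gs ++ g :: gs') P P' -> P M -> rotates_all r gs M N ->
  exists N', rotates r g N N'.
Proof.
elim: gs P M => [|h gs IH] P M /=.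
  by case=> P1 [gP _] PM ->; case: (gP _ PM).
case=> P1 [hP f] PM [M' rM]; apply: IH f _.
by case: (hP _ PM) => _; apply.
Qed.

Lemma feasible_rotation (R : realType) (n r m T k : nat) (g : rotation) :
  (0 < m < n - r)%N -> (m < T)%N ->
  (2 * m != n - r + 1)%N -> (2 * m != n - r)%N -> targets (n - r) m g ->
  @feasible R n r [:: g] (partly_annihilated r m.+1 T k)
    (partly_annihilated r m T k).
Proof.
move=> mb mT m1 m2 tg; exists (partly_annihilated r m T k); split=> // M PM.
split; first exact: rotates_exists PM.
by move=> N; apply: rotates_partly_annihilated PM.
Qed.

Lemma feasible_outward (R : realType) (n r l T k : nat) :
  (0 < l)%N -> (2 * l <= n - r + 1)%N -> (l <= T)%N ->
  @feasible R n r (outward (n - r) l) (partly_annihilated r l T k)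
    (partly_annihilated r 1 T k).
Proof.
rewrite /outward; case: l => [//|l] _; rewrite subSS subn0.
elim: l => [|l IH] lb lT; first by move=> M.
(* Reversal puts the largest number first, so the rotation with m = l + 1 is split off. *)
rewrite -[l.+1]addn1 iotaD rev_cat map_cat addn1.
apply: feasible_cat (IH _ _); try lia.
by apply: feasible_rotation; try lia; split=> /=; [|right]; congr pair; lia.
Qed.

Lemma feasible_inward (R : realType) (n r l k : nat) :
  (0 < l)%N -> (l <= (n - r)./2)%N -> ~~ odd (n - r) ->
  @feasible R n r (inward (n - r) l)
    (partly_annihilated r (n - r - l + 1) (n - r - l + 1) k)
    (partly_annihilated r ((n - r)./2 + 1) (n - r - l + 1) k).
Proof.
move=> l_gt0 lb ev; set T := (n - r - l + 1)%N.
(* Generalization to the remaining rows a, ..., d/2 with d = n - r. The known zeros then begin in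
   row d - a + 2, the mirror of row a - 1. *)
suff suffix t a : (a + t = (n - r)./2.+1)%N -> (l < a)%N ->
    @feasible R n r
      [seq Rotation (k, n - r - k + 1)%N (n - r - k + 1, n - r - k + 2)%N
      | k <- iota a t]
      (partly_annihilated r (n - r - a + 2) T k)
      (partly_annihilated r ((n - r)./2 + 1) T k).
  have := suffix ((n - r)./2 - l)%N l.+1.
  rewrite (_ : (n - r - l.+1 + 2 = T)%N); last by rewrite /T; lia.
  by apply; lia.
elim: t a => [|t IH] a at_eq la.
  by move=> M /=; rewrite (_ : (n - r - a + 2 = (n - r)./2 + 1)%N) //; lia.
rewrite -[t.+1]add1n iotaD map_cat.
apply: feasible_cat (IH _ _ _); try lia.
rewrite (_ : (n - r - a + 2 = (n - r - a + 1).+1)%N); last by lia.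
rewrite (_ : (n - r - (a + 1) + 2 = n - r - a + 1)%N); last by lia.
apply: feasible_rotation; rewrite /T; try lia.
by split=> /=; [|right]; congr pair; lia.
Qed.

Lemma feasible_schedule (R : realType) (n r l k : nat) :
  (0 < l)%N -> (2 * l <= n - r + 1)%N -> (odd (n - r) -> l = uphalf (n - r)) ->
  @feasible R n r (schedule (n - r) l)
    (partly_annihilated r (n - r - l + 1) (n - r - l + 1) k)
    (partly_annihilated r 1 (n - r - l + 1) k).
Proof.
move=> l_gt0 lb; rewrite /schedule; case: ifP => [od /(_ isT) lE|/negbT ev _].
  (* For odd order the starting row is its own mirror. *)
  have {1}-> : (n - r - l + 1 = l)%N by lia.
  by apply: feasible_outward; lia.
apply: feasible_cat (feasible_outward _ _ l_gt0 _ _); try lia.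
(* The empty list carries a change of assertion: mirror symmetry extends the zeros from rows d/2 +
   1, ..., d - l + 1 to rows l, ..., d - l + 1, as the outward phase requires. *)
rewrite -[inward _ _]cats0.
apply: feasible_cat (feasible_inward _ _ l_gt0 _ ev) _; first by lia.
move=> M [Msk Mlow Mz Mk]; split=> // i j ij ib.
have [hi|hi] := leqP (r + (n - r)./2.+1) i.+1; first by apply: Mz; lia.
by rewrite skewE // Mz ?oppr0 //; lia.
Qed.

(** * Annihilation of one antidiagonal *)

Definition reducible_state (R : realType) (n r k : nat) (M : 'M[R]_n) : Prop :=
  [/\ skew_symmetric M,
      forall i j : 'I_n, (i.+1 + j.+1 < n + 1 + r)%N -> M i j = 0
    & \rank M = k].

(** The initial zero is recorded in row d - l + 1, the mirror of row l, because the range of zeros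
    grows downwards in m from there. *)
Lemma starting_rowP (R : realType) (n r k l : nat) (M : 'M[R]_n) :
  reducible_state r k M -> starting_row r M l ->
  [/\ (0 < l)%N, (2 * l <= n - r + 1)%N, odd (n - r) -> l = uphalf (n - r)
    & partly_annihilated r (n - r - l + 1) (n - r - l + 1) k M].
Proof.
move=> [Msk Mlow Mk]; rewrite /starting_row; case: ifP => [od lE|ev].
  split=> //; try lia; split=> // i j ij ib.
  by rewrite (_ : i = j) ?skew_diag //; apply: val_inj => /=; lia.
case=> -[l_gt0 lb [i [j [/= iE jE Mij]]]] _.
have := ltn_ord i; have := ltn_ord j => jn i_n.
split=> //; try lia; split=> // i' j' ij' ib.
rewrite (_ : i' = j); last by apply: val_inj => /=; lia.
rewrite (_ : j' = i); last by apply: val_inj => /=; lia.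
by rewrite skewE // Mij oppr0.
Qed.

Lemma starting_row_exists (R : realType) (n r k : nat) (M : 'M[R]_n) :
  reducible_state r k M -> ~ antidiag_nonzero M (n + 1 + r) ->
  exists l, starting_row r M l.
Proof.
move=> [Msk _ _] nnz; rewrite /starting_row; have [_|ev] := boolP (odd (n - r)).
  by exists (uphalf (n - r)).
pose P l := [&& 0 < l, l <= n - r - l + 1 & [exists i : 'I_n, exists j : 'I_n,
  [&& i.+1 == r + l, j.+1 == r + (n - r - l + 1) & M i j == 0%R]]]%N.
have PP l : reflect (upper_zero r M l) (P l).
  apply: (iffP and3P) => -[l_gt0 lb z]; split=> //.
    have /existsP[i /existsP[j /and3P[/eqP iE /eqP jE /eqP Mij]]] := z.
    by exists i, j.
  have [i [j [/= iE jE Mij]]] := z.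
  apply/existsP; exists i; apply/existsP; exists j.
  by rewrite iE jE Mij !eqxx.
(* A zero below the diagonal is replaced by its mirror image above it. *)
have exP : exists l, P l.
  suff [i [j [ij Mij0 le_ij]]] :
      exists i j, [/\ (i, j) \in antidiagonal n (n + 1 + r), M i j = 0
                    & (i <= j)%N].
    move: ij; rewrite inE /= => /eqP ij; exists (i.+1 - r)%N; apply/PP.
    have := ltn_ord j => jn; split; try lia.
    by exists i, j; split=> //=; lia.
  have : [exists ij in antidiagonal n (n + 1 + r), M ij.1 ij.2 == 0].
    apply: contra_notT nnz => /existsPn nz i j ij.
    by have := nz (i, j); rewrite negb_and ij.
  case/existsP=> -[i j] /= /andP[ij /eqP Mij]; have [le_ij|/ltnW le_ji] := leqP i j.
    by exists i, j.
  exists j, i; split=> //; first by move: ij; rewrite !inE /= addnC.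
  by rewrite skewE // Mij oppr0.
have Pub l : P l -> (l <= n)%N.
  by case/PP=> _ _ [i [j [/= iE _ _]]]; have := ltn_ord i; lia.
(* The index difference shrinks as l grows, so the largest row number attains the minimum. *)
case: (ex_maxnP exP Pub) => l /PP zl maxl; exists l; split=> // k' /PP /maxl.
lia.
Qed.

Lemma annihilation_state (R : realType) (n r k : nat) (M N : 'M[R]_n) :
  reducible_state r k M -> annihilation r M N -> reducible_state r.+1 k N.
Proof.
move=> Mst [l lst rot]; have [l_gt0 lb lod PM] := starting_rowP Mst lst.
have [Nsk Nlow Nz Nk] :=
  feasible_invariant (feasible_schedule R k l_gt0 lb lod) PM rot.
split=> // i j ij.
have [ij'|ij'] := ltnP (i.+1 + j.+1)%N (n + 1 + r); first exact: Nlow.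
have := ltn_ord i; have := ltn_ord j => jn i_n.
(* As 2 l <= d + 1, the rows 1, ..., d - l + 1 contain the upper half of the antidiagonal; the lower
   half is its mirror. *)
have [le_ij|lt_ji] := leqP i j; first by apply: Nz; lia.
by rewrite skewE // Nz ?oppr0 //; lia.
Qed.

Lemma annihilation_exists (R : realType) (n r k : nat) (M : 'M[R]_n) :
  reducible_state r k M -> ~ antidiag_nonzero M (n + 1 + r) ->
  exists N, annihilation r M N.
Proof.
move=> Mst nnz; have [l lst] := starting_row_exists Mst nnz.
have [l_gt0 lb lod PM] := starting_rowP Mst lst.
have [N rot] := feasible_exists (feasible_schedule R k l_gt0 lb lod) PM.
by exists N, l.
Qed.

Lemma annihilation_never_blocked (R : realType) (n r k : nat) (M : 'M[R]_n) :
  reducible_state r k M -> ~ antidiag_nonzero M (n + 1 + r) ->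
  annihilation_unblocked r M.
Proof.
move=> Mst nnz; split; first exact: starting_row_exists Mst nnz.
move=> l gs g gs' M' lst sE; have [l_gt0 lb lod PM] := starting_rowP Mst lst.
have f := feasible_schedule R k l_gt0 lb lod; rewrite sE in f.
exact: feasible_next f PM.
Qed.

(** * Iteration over the antidiagonals, termination and rank *)

(** These antidiagonals are empty, so the process stops at r = n at the latest, where the rank is
    0. *)
Lemma antidiag_nonzero_beyond (R : realType) (n r : nat) (M : 'M[R]_n) :
  (n <= r)%N -> antidiag_nonzero M (n + 1 + r).
Proof.
move=> le_nr i j; rewrite inE /= => /eqP.
by have := ltn_ord i; have := ltn_ord j; lia.
Qed.

Lemma reached_le (R : realType) (n r : nat) (M N : 'M[R]_n) :
  reached M r N -> (r <= n)%N.
Proof.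
elim=> // {}r N' N'' _ le_rn nnz _; rewrite ltnNge; apply/negP => le_nr.
exact/nnz/antidiag_nonzero_beyond.
Qed.

Lemma reached_state (R : realType) (n k r : nat) (M N : 'M[R]_n) :
  reducible_state 0 k M -> reached M r N -> reducible_state r k N.
Proof. by move=> Mst; elim=> // {}r N' N'' _ N'st _; apply: annihilation_state. Qed.

Lemma reached_end (R : realType) (n k r : nat) (M N : 'M[R]_n) :
  reducible_state r k N -> reached M r N ->
  exists r' N', reached M r' N' /\ antidiag_nonzero N' (n + 1 + r').
Proof.
(* Induction on the number of antidiagonals left. *)
move Et : (n - r)%N => t; elim: t r N Et => [|t IH] r N Et Nst rN.
  by exists r, N; split=> //; apply: antidiag_nonzero_beyond; lia.
have [/'forall_implyP nz|nz] := boolP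
    [forall ij : 'I_n * 'I_n,
       (ij \in antidiagonal n (n + 1 + r)) ==> (N ij.1 ij.2 != 0)].
  by exists r, N; split=> // i j /nz.
have nnz : ~ antidiag_nonzero N (n + 1 + r).
  move=> N0; case/negP: nz; apply/'forall_implyP => -[i j]; exact: N0.
have [N' ann] := annihilation_exists Nst nnz.
apply: (IH r.+1 N'); [by lia | exact: annihilation_state Nst ann |].
exact: reachedS rN nnz ann.
Qed.

Lemma reducible_rank (R : realType) (n r k : nat) (M : 'M[R]_n) :
  (r <= n)%N -> reducible_state r k M -> antidiag_nonzero M (n + 1 + r) ->
  k = (n - r)%N.
Proof. by move=> le_rn [_ Mlow <-]; apply: rank_antitriangular. Qed.

Theorem mainTheorem2 (R : realType) (n : nat) (A Q M : 'M[R]_n)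
    (A_skew : skew_symmetric A)
    (Q_orth : orthogonal_mx Q)
    (A_eq : A = Q *m M *m Q^T)
    (M_anti : lower_antitriangular M)
    (M_zero : exists i j, (i, j) \in antidiagonal n (n + 1) /\ M i j = 0) :
  [/\ exists N, annihilation 0 M N,
      forall N, annihilation 0 M N ->
        [/\ lower_antitriangular N,
            antidiag_zero N (n + 1)
          & antidiag_nonzero N (n + 2) -> \rank A = (n - 1)%N],
      exists r N, reached M r N /\ antidiag_nonzero N (n + 1 + r)
    & forall r N, reached M r N ->
        [/\ forall s, (s < n + 1 + r)%N -> antidiag_zero N s,
            antidiag_nonzero N (n + 1 + r) ->
              \rank A = #|antidiagonal n (n + 1 + r)|
          & ~ antidiag_nonzero N (n + 1 + r) -> annihilation_unblocked r N]].
Proof.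
have [QQt QtQ] := Q_orth; have [uQ _] := mulmx1_unit QQt.
(* M = Q^T A Q inherits skew-symmetry and rank from A. *)
have Mst : reducible_state 0 (\rank A) M.
  split; last by rewrite A_eq mxrank_similar.
    rewrite (_ : M = Q^T *m A *m Q^T^T); first exact: skew_similar.
    by rewrite A_eq trmxK !mulmxA QtQ mul1mx -mulmxA QtQ mulmx1.
  by move=> i j ij; apply: M_anti; lia.
have nnz : ~ antidiag_nonzero M (n + 1 + 0).
  by case: M_zero => i [j [ij /eqP Mij]] /(_ i j); rewrite addn0 ij Mij => /(_ isT).
have n_gt0 : (0 < n)%N by case: M_zero => i _; apply: leq_trans (ltn_ord i).
split.
- exact: annihilation_exists Mst nnz.
- move=> N /(annihilation_state Mst) Nst; have [_ Nlow _] := Nst; split.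
  + by move=> i j ij; apply: Nlow; lia.
  + by move=> i j; rewrite inE /= => /eqP ij; apply: Nlow; lia.
  (* The antidiagonal n + 2 is the case r = 1, and r <= n holds by [n_gt0]. *)
  + by rewrite -[(n + 2)%N]/(n + (1 + 1))%N addnA; apply: reducible_rank Nst.
- exact: reached_end Mst (reached0 M).
- move=> r N rN; have Nst := reached_state Mst rN; have le_rn := reached_le rN.
  split.
  + move=> s s_lt i j; rewrite inE /= => /eqP ij.
    by have [_ Nlow _] := Nst; apply: Nlow; lia.
  + by rewrite card_antidiagonal //; apply: reducible_rank Nst.
  + exact: annihilation_never_blocked Nst.
Qed.
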